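(* (i) If the data is Gaussian, $\boldsymbol{x}\sim\mathcal{N}(\boldsymbol{\mu},\Sigma)$ in $\mathbb{R}^d$ with $\boldsymbol{\mu}\neq\mathbf{0}$, and the per-sample loss $\ell$ is a convex function with a unique minimum, then the optimal weight direction $\hat{\boldsymbol{S}}_{\min}=\boldsymbol{S}_{\min}/\|\boldsymbol{S}_{\min}\|$, where $\boldsymbol{S}_{\min}=\operatorname{arg\,min}_{\boldsymbol{S}}\mathbb{E}[\ell(\boldsymbol{S}^\top\boldsymbol{x})]$, satisfies $$\hat{\boldsymbol{S}}_{\min}\propto\Sigma^{-1}\boldsymbol{\mu}.$$ (ii) Similarly, for arbitrary data $\boldsymbol{x}_1,\dots,\boldsymbol{x}_N\in\mathbb{R}^d$, if $\lambda=d/N<1$ and the per-sample loss is quadratic, $\ell(z)=a(z-z^* )^2$, then the direction $\hat{\boldsymbol{S}}_{\min}=\boldsymbol{S}_{\min}/\|\boldsymbol{S}_{\min}\|$ of $\boldsymbol{S}_{\min}=\operatorname{arg\,min}_{\boldsymbol{S}}\frac1N\sum_{i=1}^N\ell(\boldsymbol{S}^\top\boldsymbol{x}_i)$ satisfies $$\hat{\boldsymbol{S}}_{\min}\propto\Sigma^{-1}\boldsymbol{\mu},$$ where now $\boldsymbol{\mu}=\frac1N\sum_{i}\boldsymbol{x}_i$ and $\Sigma=\frac1N\sum_{i}(\boldsymbol{x}_i-\boldsymbol{\mu})(\boldsymbol{x}_i-\boldsymbol{\mu})^\top$ are the empirical mean and the empirical centered covariance.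
   Context: The setting is binary linear classification with zero bias and weight vector $\boldsymbol{S}\in\mathbb{R}^d$. The label $y\in\{-1,+1\}$ has been absorbed into the input (that is, $\boldsymbol{x}$ stands for $y\boldsymbol{x}$), so the per-sample loss is a function $\ell(z)$ of the scalar logit $z=\boldsymbol{S}^\top\boldsymbol{x}$.
   Formalization: The covariance Σ is assumed invertible in both parts (in (ii), d/N<1 alone does not ensure it, e.g. all data points equal) and the minimizer S_min is assumed nonzero so that its direction is defined; the proportionality constant is nonzero, of either sign. *)

(* Defs.v *)
From HB Require Import structures.
From mathcomp Require Import all_boot all_order all_algebra.
From mathcomp Require Import all_classical all_reals all_analysis.

Set Implicit Arguments.
Unset Strict Implicit.
Unset Printing Implicit Defensive.

Import Order.TTheory GRing.Theory Num.Theory.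

Local Open Scope classical_set_scope.
Local Open Scope ring_scope.

Definition dot (R : realType) (d : nat) (u v : 'cV[R]_d) : R := (u^T *m v) 0 0.

(* Euclidean norm: the library's `|v| on matrices is the sup norm. *)
Definition enorm (R : realType) (d : nat) (v : 'cV[R]_d) : R :=
  Num.sqrt (dot v v).

(* S / ||S||; only meaningful for S != 0, since 0^-1 = 0. *)
Definition direction (R : realType) (d : nat) (S : 'cV[R]_d) : 'cV[R]_d :=
  (enorm S)^-1 *: S.

(* The constant may be negative: the sign is that of the minimizing logit of
   the loss. *)
Definition propto (R : realType) (d : nat) (u v : 'cV[R]_d) : Prop :=
  exists2 c : R, c != 0 & u = c *: v.

Definition is_argmin (U : Type) (disp : Order.disp_t) (V : porderType disp)
    (f : U -> V) (s : U) : Prop :=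
  forall s' : U, (f s <= f s')%O.

Definition has_unique_min (R : realType) (l : R -> R) : Prop :=
  exists z0 : R, forall z : R, z != z0 -> l z0 < l z.

Definition convex_loss (R : realType) (l : R -> R) : Prop :=
  @convex_function R R^o setT l.

(* Univariate normal law with mean m and variance v.  The library's normal_prob
   takes the standard deviation, and normal_prob m 0 is uniform on [0, 1]
   instead of the Dirac mass at m, hence the case distinction. *)
Definition normal_law (R : realType) (m v : R) (A : set R) : \bar R :=
  if v == 0 then \d_m A else normal_prob m (Num.sqrt v) A.

(* X ~ N(mu, Sigma): X is a random vector all of whose linear functionals u^T X
   are (possibly degenerate) normal, with mean u^T mu and variance
   u^T Sigma u. *)
Definition gaussian_vector (R : realType) (disp : measure_display)
    (T : measurableType disp) (P : probability T R) (d : nat)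
    (X : T -> 'cV[R]_d) (mu : 'cV[R]_d) (Sigma : 'M[R]_d) : Prop :=
  [/\ Sigma^T = Sigma,
      forall u : 'cV[R]_d, 0 <= dot u (Sigma *m u),
      forall i : 'I_d, measurable_fun [set: T] (fun w : T => X w i 0) &
      forall (u : 'cV[R]_d) (A : set R), measurable A ->
        P [set w | A (dot u (X w))] =
        normal_law (dot u mu) (dot u (Sigma *m u)) A].

(* Extended-real valued; for l bounded below (as is any l with a minimum) the
   integral is well defined, possibly equal to +oo. *)
Definition expected_loss (R : realType) (disp : measure_display)
    (T : measurableType disp) (P : probability T R) (d : nat)
    (X : T -> 'cV[R]_d) (l : R -> R) (S : 'cV[R]_d) : \bar R :=
  'E_P[fun w : T => l (dot S (X w))].

Definition empirical_loss (R : realType) (d N : nat) (x : 'I_N -> 'cV[R]_d)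
    (l : R -> R) (S : 'cV[R]_d) : R :=
  N%:R^-1 * \sum_(i < N) l (dot S (x i)).

Definition empirical_mean (R : realType) (d N : nat) (x : 'I_N -> 'cV[R]_d) :
    'cV[R]_d :=
  N%:R^-1 *: \sum_(i < N) x i.

Definition empirical_cov (R : realType) (d N : nat) (x : 'I_N -> 'cV[R]_d) :
    'M[R]_d :=
  N%:R^-1 *: \sum_(i < N)
    ((x i - empirical_mean x) *m (x i - empirical_mean x)^T).

Definition quadratic_loss (R : realType) (a z0 z : R) : R := a * (z - z0) ^+ 2.

(* Main.v *)
Require Import Defs.
From HB Require Import structures.
From mathcomp Require Import all_boot all_order all_algebra.
From mathcomp Require Import all_classical all_reals all_analysis.
From mathcomp Require Import measurable_realfun ring lra.

(* (i) Write b = Sigma^-1 mu and split the minimizer as S = c b + V with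
   V . mu = 0. If V != 0, the Gaussian logits of c b and S have the same mean m,
   but that of c b has the smaller variance. With Y the logit of S, the logit of
   c b is distributed as m + r (Y - m) with 0 <= r < 1, a convex combination of
   Y and its reflection 2 m - Y, which has the law of Y. Convexity of the loss
   then gives a smaller expected loss at c b, strictly so because Y and 2 m - Y
   lie on opposite sides of the minimum of the loss with positive probability;
   so V = 0. The expectation at S is finite since that at 0 is.
   (ii) Stationarity of the quadratic empirical loss reads
   (cov + mu mu^T) S = z* mu, that is, cov S = (z* - mu . S) mu. *)

Import Order.TTheory GRing.Theory Num.Theory.
Local Open Scope classical_set_scope.
Local Open Scope ring_scope.

(** First-order condition: near [t = 0] the linear term dominates, and it changes sign with [t]. No
    sign is assumed on [c]. *)
Lemma linear_term_eq0 (R : realFieldType) (b c : R) :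
  (forall t, 0 <= t * b + t ^+ 2 * c) -> b = 0.
Proof.
move=> h; apply/eqP/negP => /negP b0.
have c1 : 0 < `|c| + 1 by rewrite ltr_wpDl.
(* A step against the sign of [b], short enough that the factor [c - (|c| + 1)] below is
   negative. *)
have := h (- b / (`|c| + 1)); apply/negP; rewrite -ltNge.
have -> : - b / (`|c| + 1) * b + (- b / (`|c| + 1)) ^+ 2 * c =
    (b / (`|c| + 1)) ^+ 2 * (c - (`|c| + 1)).
  by field; rewrite gt_eqF.
rewrite pmulr_rlt0; first by have := ler_norm c; lra.
by rewrite exprn_even_gt0//= mulf_neq0// invr_eq0 gt_eqF.
Qed.

(** * Euclidean inner product and semidefinite quadratic forms *)

Section dot.
Context {R : realType} {d : nat}.
Implicit Types (u v w : 'cV[R]_d) (c : R).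

Lemma dotE u v : dot u v = \sum_i u i 0 * v i 0.
Proof. by rewrite /dot mxE; apply: eq_bigr => i _; rewrite mxE. Qed.

Lemma dotC u v : dot u v = dot v u.
Proof. by rewrite !dotE; apply: eq_bigr => i _; rewrite mulrC. Qed.

Lemma dotDl u v w : dot (u + v) w = dot u w + dot v w.
Proof. by rewrite /dot linearD mulmxDl mxE. Qed.

Lemma dotZl c u v : dot (c *: u) v = c * dot u v.
Proof. by rewrite /dot linearZ -scalemxAl mxE. Qed.

Lemma dotDr u v w : dot w (u + v) = dot w u + dot w v.
Proof. by rewrite !(dotC w) dotDl. Qed.

Lemma dotZr c u v : dot u (c *: v) = c * dot u v.
Proof. by rewrite !(dotC u) dotZl. Qed.

Lemma dotNl u v : dot (- u) v = - dot u v.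
Proof. by rewrite -scaleN1r dotZl mulN1r. Qed.

Lemma dotNr u v : dot u (- v) = - dot u v.
Proof. by rewrite !(dotC u) dotNl. Qed.

Lemma dot0l u : dot 0 u = 0.
Proof. by rewrite -(scale0r 0) dotZl mul0r. Qed.

Lemma dot_sumr n (x : 'I_n -> 'cV[R]_d) u :
  dot u (\sum_i x i) = \sum_i dot u (x i).
Proof. by rewrite /dot mulmx_sumr summxE. Qed.

Lemma dot_ge0 u : 0 <= dot u u.
Proof. by rewrite dotE sumr_ge0// => i _; rewrite -expr2 sqr_ge0. Qed.

Lemma dot_eq0 u : (dot u u == 0) = (u == 0).
Proof.
apply/idP/idP => [|/eqP->]; last by rewrite dot0l.
rewrite dotE psumr_eq0; last by move=> i _; rewrite -expr2 sqr_ge0.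
move=> /allP h; apply/eqP/matrixP => i j; rewrite ord1 mxE.
by have := h i (mem_index_enum i); rewrite /= mulf_eq0 orbb => /eqP.
Qed.

Lemma dot_symmx (A : 'M[R]_d) u v : A^T = A -> dot u (A *m v) = dot v (A *m u).
Proof. by move=> sA; rewrite dotC /dot trmx_mul sA mulmxA. Qed.

Lemma mul_outer u v : (u *m u^T) *m v = dot u v *: u.
Proof. by rewrite -mulmxA [u^T *m v]mx11_scalar mul_mx_scalar. Qed.

(** If the form vanished at [u], it would be minimal there, so its derivative [2 * dot w (A *m u)]
    would vanish in every direction [w]. The choice [w = A *m u] then gives [A *m u = 0], against
    invertibility. *)
Lemma psd_unitmx_gt0 {A : 'M[R]_d} {u} : A^T = A ->
  (forall w, 0 <= dot w (A *m w)) -> A \in unitmx -> u != 0 ->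
  0 < dot u (A *m u).
Proof.
move=> sA psdA uA; rewrite ltNge; apply: contra_neqN => q0.
have {}q0 : dot u (A *m u) = 0 by apply/le_anti; rewrite q0 psdA.
have orth w : dot w (A *m u) = 0.
  suff : 2 * dot w (A *m u) = 0 by move/eqP; rewrite mulf_eq0 pnatr_eq0 => /eqP.
  apply: (@linear_term_eq0 _ _ (dot w (A *m w))) => t.
  have := psdA (u + t *: w).
  rewrite mulmxDr -scalemxAr !(dotDl, dotDr, dotZl, dotZr) q0.
  rewrite (@dot_symmx _ u w sA); congr (_ <= _); ring.
have /eqP := orth (A *m u); rewrite dot_eq0 => /eqP Au0.
by rewrite -[u](mulKmx uA) Au0 mulmx0.
Qed.

Lemma propto_direction c u v : u = c *: v -> u != 0 -> propto (direction u) v.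
Proof.
move=> uE u0; exists ((enorm u)^-1 * c); last first.
  by rewrite /direction -scalerA -uE.
rewrite mulf_neq0//.
  rewrite invr_eq0 /enorm sqrtr_eq0 -ltNge lt_neqAle dot_ge0 andbT eq_sym.
  by rewrite dot_eq0.
by apply: contraNneq u0 => c0; rewrite uE c0 scale0r.
Qed.

End dot.

(** * Empirical moments and stationarity of the quadratic loss *)

Lemma empirical_covE (R : realType) (d N : nat) (x : 'I_N -> 'cV[R]_d) :
  (0 < N)%N ->
  empirical_cov x = N%:R^-1 *: (\sum_i (x i *m (x i)^T)) -
    empirical_mean x *m (empirical_mean x)^T.
Proof.
move=> N0; have N0' : N%:R != 0 :> R by rewrite pnatr_eq0 -lt0n.
have : \sum_i x i = N%:R *: empirical_mean x by rewrite scalerA mulfV// scale1r.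
rewrite /empirical_cov; move: (empirical_mean x) => m sumx.
under eq_bigr do rewrite linearB /= mulmxBl !mulmxBr.
rewrite !sumrB -mulmx_suml -mulmx_sumr -linear_sum /= sumx linearZ /=.
rewrite -scalemxAl.
rewrite sumr_const card_ord -(scaler_nat N (m *m m^T)).
rewrite linearZ /= -scalemxAr.
by rewrite scalerN subrr subr0 scalerBr scalerA mulVf// scale1r.
Qed.

(** The sum [g] is the gradient up to the nonzero factor [2 * a / N]. Moving [S] along [g] itself
    changes the loss by an exact quadratic in the step, whose linear coefficient is that factor
    times [dot g g]. *)
Lemma empirical_loss_stationary (R : realType) (d N : nat)
    (x : 'I_N -> 'cV[R]_d) (a z : R) (S : 'cV[R]_d) : (0 < N)%N -> a != 0 ->
  is_argmin (empirical_loss x (quadratic_loss a z)) S ->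
  \sum_i (dot S (x i) - z) *: x i = 0.
Proof.
move=> N0 a0 Smin; have Ni : 0 < N%:R^-1 :> R by rewrite invr_gt0 ltr0n.
set g := \sum_i _.
suff /eqP : (N%:R^-1 * (2 * a)) * dot g g = 0.
  by rewrite !mulf_eq0 (gt_eqF Ni) pnatr_eq0 (negbTE a0) dot_eq0 => /eqP.
have gE : dot g g = \sum_i (dot S (x i) - z) * dot g (x i).
  by rewrite {2}/g dot_sumr; apply: eq_bigr => i _; rewrite dotZr.
apply: (@linear_term_eq0 _ _ (N%:R^-1 * (a * \sum_i dot g (x i) ^+ 2))) => t.
have := Smin (S + t *: g); rewrite -subr_ge0; congr (_ <= _).
rewrite /empirical_loss gE -mulrBr -sumrB !mulr_sumr -big_split /=.
apply: eq_bigr => i _; rewrite dotDl dotZl /quadratic_loss; ring.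
Qed.

(** * Convex functions with a unique minimum *)

Section convex_loss.
Context {R : realType} {l : R -> R}.
Implicit Types t x y z : R.

Hypothesis cvx : convex_loss l.

Lemma convex_lossP t x y : 0 <= t <= 1 ->
  l (t * x + (1 - t) * y) <= t * l x + (1 - t) * l y.
Proof.
(* [convex_function] ranges over weights bundled with a proof that they lie in [[0, 1]]; [tI] is
   that proof for [t]. *)
move=> /andP[t0 t1]; have tI : Itv.spec (@Itv.num_sem R)
    (Itv.Real `[0%Z, 1%Z]) t.
  by rewrite /Itv.spec /= /Itv.num_sem /= num_real /= in_itv/= t0 t1.
have := @cvx (Itv.mk tI) x y; rewrite !inE => /(_ I I).
by rewrite !convRE.
Qed.

(** Strict sublevel sets of a convex function are intervals, and open left rays generate the Borel
    sets. *)
Lemma measurable_convex_loss : measurable_fun setT l.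
Proof.
apply: (measurability _ (RGenInftyO.measurableE R)) => //= _ [_ [c ->] <-].
rewrite setTI; apply: is_interval_measurable => x y /=.
rewrite !in_itv /= => lx ly z /andP[xz zy].
have [yx|xy] := leP y x.
  by have -> : z = x by apply/le_anti; rewrite xz (le_trans zy).
have xy0 : 0 < y - x by rewrite subr_gt0.
pose t := (y - z) / (y - x).
have t01 : 0 <= t <= 1.
  by rewrite divr_ge0 ?subr_ge0// ?(ltW xy)// ler_pdivrMr//; lra.
have -> : z = t * x + (1 - t) * y by rewrite /t; field; rewrite gt_eqF.
apply: (le_lt_trans (convex_lossP _ x y t01)).
have lxM : l x <= Num.max (l x) (l y) by rewrite le_max lexx.
have lyM : l y <= Num.max (l x) (l y) by rewrite le_max lexx orbT.
have Mc : Num.max (l x) (l y) < c by rewrite gt_max lx.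
by move/andP: t01 => [t0 t1]; nra.
Qed.

Context {z0 : R}.
Hypothesis z0_min : forall z, z != z0 -> l z0 < l z.

Lemma convex_loss_min_le z : l z0 <= l z.
Proof. by have [->//|/z0_min/ltW] := eqVneq z z0. Qed.

(* Compare on the segment from x to z0: at z0 the chord of l through x and y
   lies strictly above l, and at x it meets l. *)
Let chord_lt t x y : 0 < t < 1 -> (x - z0) * (y - z0) < 0 ->
  0 <= (t * x + (1 - t) * y - z0) * (x - z0) ->
  l (t * x + (1 - t) * y) < t * l x + (1 - t) * l y.
Proof.
move=> /andP[t0 t1] xy xz.
have x0 : x - z0 != 0 by apply: contraTneq xy => ->; rewrite mul0r ltxx.
have y0 : y - z0 != 0 by apply: contraTneq xy => ->; rewrite mulr0 ltxx.
have lx : l z0 < l x by apply: z0_min; rewrite -subr_eq0.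
have ly : l z0 < l y by apply: z0_min; rewrite -subr_eq0.
(* The position of the combination on the segment from [z0] ([s = 0]) to [x] ([s = 1]). As [y] lies
   beyond [z0], [s < t], and the chord exceeds the bound [s * l x + (1 - s) * l z0] by [(t - s) * (l
   x - l z0) + (1 - t) * (l y - l z0)]. *)
pose s := (t * x + (1 - t) * y - z0) / (x - z0).
have s0 : 0 <= s.
  rewrite /s -(@pmulr_lge0 _ ((x - z0) ^+ 2)) ?exprn_even_gt0//.
  by rewrite expr2 mulrA divfK.
have xz2 : 0 < (x - z0) ^+ 2 by rewrite exprn_even_gt0.
have st : t - s = (1 - t) * (- (x - z0) * (y - z0)) / (x - z0) ^+ 2.
  by rewrite /s; field.
have st0 : 0 < t - s by rewrite st divr_gt0// mulr_gt0; nra.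
have -> : t * x + (1 - t) * y = s * x + (1 - s) * z0 by rewrite /s; field.
apply: (le_lt_trans (convex_lossP _ x z0 _)); first by apply/andP; split; lra.
by nra.
Qed.

(** The combination lies on the side of [z0] of either [x] or [y]; the second case is the first with
    the endpoints exchanged. *)
Lemma convex_loss_lt t x y : 0 < t < 1 -> (x - z0) * (y - z0) < 0 ->
  l (t * x + (1 - t) * y) < t * l x + (1 - t) * l y.
Proof.
move=> t01 xy.
have [|zx] := leP 0 ((t * x + (1 - t) * y - z0) * (x - z0)).
  exact: chord_lt.
have := @chord_lt (1 - t) y x; rewrite subKr ![(1 - t) * _ + _]addrC; apply.
- by move/andP: t01 => [? ?]; apply/andP; split; lra.
- by rewrite mulrC.
- move: zx; set p := _ + _ - z0 => zx; rewrite leNgt; apply/negP => zy.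
  have : 0 < (p * (x - z0)) * (p * (y - z0)) by rewrite nmulr_rgt0.
  rewrite mulrACA -expr2 pmulr_rgt0 ?ltNge ?(ltW xy)// -ltNge.
  by rewrite exprn_even_gt0//=; apply: contraTneq zx => ->; rewrite mul0r ltxx.
Qed.

End convex_loss.

(** * Normal laws on the line: translation and tails *)

Lemma lebesgue_measure_shift (R : realType) (c : R) (A : set R) :
  measurable A ->
  pushforward lebesgue_measure (fun x : measurableTypeR R => x + c) A =
  lebesgue_measure A.
Proof.
move=> mA; pose f (x : measurableTypeR R) : measurableTypeR R := x + c.
have mf : measurable_fun setT f by exact: measurable_funD.
pose mfun_mixin := isMeasurableFun.Build _ _ _ _ f mf.
pose F : {mfun measurableTypeR R >-> measurableTypeR R} := HB.pack f mfun_mixin.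
apply/esym/(@lebesgue_measure_unique _ (pushforward lebesgue_measure F)) => //.
move=> _ [[a b]] _ <-.
have FE : F @^-1` `]a, b]%classic = `]a - c, b - c]%classic.
  by apply/seteqP; split => x /=; rewrite !in_itv/= ltrBlDr lerBrDr.
rewrite /= /pushforward FE !lebesgue_measure_itv/= !lte_fin ltrD2r.
by case: ifP => // _; rewrite -EFinB -[in RHS]EFinB; congr (_%:E); ring.
Qed.

(** For a Dirac mass this is a computation; otherwise it is the change of variable [y = x + c],
    under which Lebesgue measure is invariant. *)
Lemma normal_law_shift (R : realType) (m v c : R) (A : set R) :
  0 <= v -> measurable A ->
  normal_law m v (fun x => A (x + c)) = normal_law (m + c) v A.
Proof.
move=> v_ge0 mA; rewrite /normal_law; case: ifPn => v0; first by [].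
have s0 : Num.sqrt v != 0 by rewrite sqrtr_eq0 -ltNge lt_neqAle eq_sym v0.
set s := Num.sqrt v in s0 *; rewrite /normal_prob.
pose f (x : measurableTypeR R) : measurableTypeR R := x + c.
have mf : measurable_fun setT f by exact: measurable_funD.
transitivity (\int[lebesgue_measure]_(x in f @^-1` A)
    ((fun y => (normal_pdf (m + c) s y)%:E) \o f) x)%E.
  apply: eq_integral => x _; rewrite /= !normal_pdfE// /normal_fun.
  by have -> : f x - (m + c) = x - m by rewrite /f; ring.
rewrite -(@ge0_integral_pushforward _ _ _ _ _ f mf)//.
- by apply: eq_measure_integral => B mB _; exact: lebesgue_measure_shift.
- apply/measurable_EFinP; apply: measurable_funTS; exact: measurable_normal_pdf.
- by move=> y _; rewrite lee_fin normal_pdf_ge0.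
Qed.

Lemma normal_prob_tail_gt0 (R : realType) (m s K : R) : s != 0 ->
  (0 < normal_prob m s [set x | K < x - m]%R)%E.
Proof.
(* The density decreases to the right of [m], so on the unit interval [I], contained in the tail, it
   is at least its value [c] at the right endpoint. *)
move=> s0; pose c := normal_pdf m s (m + (`|K| + 2)).
have c0 : 0 < c.
  by rewrite /c normal_pdfE// mulr_gt0 ?normal_peak_gt0 ?expR_gt0.
pose I : set R := `[m + (`|K| + 1), m + (`|K| + 2)]%classic.
have KK := ler_norm K.
apply: (@lt_le_trans _ _ (\int[lebesgue_measure]_(x in I) c%:E)%E).
  rewrite integral_cst; last exact: measurable_itv.
  rewrite /I /= lebesgue_measure_itv/= lte_fin ltrD2l ltrD2l ltr1n.
  by rewrite -EFinB -EFinM lte_fin mulr_gt0//; lra.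
apply: (@le_trans _ _ (normal_prob m s I)).
  apply: ge0_le_integral => //=.
  - exact: measurable_itv.
  - by move=> x _; rewrite lee_fin ltW.
  - by apply/measurable_EFinP/measurable_funTS; exact: measurable_normal_pdf.
  move=> x; rewrite /I/= in_itv/= => /andP[x1 x2].
  rewrite lee_fin /c !normal_pdfE// ler_pM2l ?normal_peak_gt0// ler_expR.
  rewrite ler_pM2r ?invr_gt0 ?pmulrn_lgt0 ?exprn_even_gt0//.
  by have := normr_ge0 K; nra.
apply: le_measure; rewrite ?inE.
- exact: measurable_itv.
- rewrite [X in measurable X](_ : _ = `]K + m, +oo[%classic).
    exact: measurable_itv.
  by apply/seteqP; split => x; rewrite /= in_itv/= andbT ltrBrDr.
- by move=> x; rewrite /I/= in_itv/= => /andP[x1 _]; lra.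
Qed.

(** * Expected convex losses of real random variables *)

Section laws.
Context {R : realType} {disp : measure_display} {T : measurableType disp}.
Variable P : probability T R.

(** Positive and negative parts are transported separately to integrals against the image measures,
    so [f] need not be integrable. *)
Lemma expectation_eq_law (Y Z f : _ -> R) :
  measurable_fun setT Y -> measurable_fun setT Z -> measurable_fun setT f ->
  (forall A, measurable A -> P (Y @^-1` A) = P (Z @^-1` A)) ->
  ('E_P[f \o Y] = 'E_P[f \o Z])%E.
Proof.
move=> mY mZ mf YZ.
have ge0_eq (g : R -> \bar R) : measurable_fun setT g ->
    (forall x, 0 <= g x)%E -> forall V W : T -> \bar R,
    V =1 g \o Y -> W =1 g \o Z -> (\int[P]_w V w = \int[P]_w W w)%E.
  move=> mg g0 V W /funext-> /funext->.
  rewrite -[LHS](@ge0_integral_pushforward _ _ _ _ _ _ mY _ setT) //.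
  rewrite -[RHS](@ge0_integral_pushforward _ _ _ _ _ _ mZ _ setT) //.
  by apply: eq_measure_integral => A mA _; exact: YZ.
rewrite unlock integralE [RHS]integralE; congr (_ - _)%E.
  apply: (ge0_eq (EFin \o f)^\+%E) => // [|x|x]; last 2 first.
  - by rewrite /= !funeposE.
  - by rewrite /= !funeposE.
  by apply/measurable_funepos/measurable_EFinP.
apply: (ge0_eq (EFin \o f)^\-%E) => // [|x|x]; last 2 first.
- by rewrite /= !funenegE.
- by rewrite /= !funenegE.
by apply/measurable_funeneg/measurable_EFinP.
Qed.

Context {l : R -> R} {z0 : R}.
Hypothesis cvx : convex_loss l.
Hypothesis z0_min : forall z, z != z0 -> l z0 < l z.

(** The loss is at least [l z0], so its negative part is at most [|l z0|] and has a finite integral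
    under a probability; finiteness from above then controls the positive part. *)
Lemma convex_loss_integrable (Y : T -> R) : measurable_fun setT Y ->
  ('E_P[l \o Y] < +oo)%E -> P.-integrable setT (EFin \o (l \o Y)).
Proof.
move=> mY Ylt.
have mlY : measurable_fun setT (l \o Y).
  by apply: measurableT_comp => //; exact: measurable_convex_loss.
have meY : measurable_fun setT (EFin \o (l \o Y)) by exact/measurable_EFinP.
have neg_lt : (\int[P]_w (EFin \o (l \o Y))^\- w < +oo)%E.
  apply: (@le_lt_trans _ _ (\int[P]_w (`|l z0|%:E))%E); last first.
    by rewrite integral_cst//= probability_setT mule1 ltry.
  apply: ge0_le_integral => //=.
  - exact: measurable_funeneg.
  - move=> w _; rewrite funenegE /= -EFin_max lee_fin ge_max normr_ge0 andbT.
    have := convex_loss_min_le z0_min (Y w); have := ler_norm (- l z0).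
    by rewrite normrN; lra.
apply/integrableP; split => //.
rewrite -[X in integral _ _ X]/(abse \o (EFin \o (l \o Y))) fune_abse.
rewrite ge0_integralD//=;
  [|exact: measurable_funepos|exact: measurable_funeneg].
rewrite lte_add_pinfty//.
move: Ylt; rewrite unlock integralE.
have : (\int[P]_w (EFin \o (l \o Y))^\- w)%E \is a fin_num.
  by rewrite ge0_fin_numE// integral_ge0.
move=> /fineK <-; rewrite lteBlDr// => /lt_le_trans; apply; exact: leey.
Qed.

(** If the expectation did not drop, the nonnegative gap [D] between the chord and the loss would
    integrate to zero and vanish almost everywhere, although it is positive on an event of positive
    probability. *)
Lemma expected_loss_contraction_lt (Y : T -> R) (m r : R) :
  measurable_fun setT Y ->
  (forall A, measurable A ->
    P (Y @^-1` A) = P ((fun w => 2 * m - Y w) @^-1` A)) ->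
  (0 < P [set w | `|m - z0| < Y w - m]%R)%E ->
  0 <= r < 1 -> ('E_P[l \o Y] < +oo)%E ->
  ('E_P[l \o (fun w => m + r * (Y w - m))%R] < 'E_P[l \o Y])%E.
Proof.
move=> mY symY tail /andP[r0 r1] Ylt; rewrite ltNge; apply/negP => le_YZ.
set Z := (fun w => _) in le_YZ; pose Y' w := 2 * m - Y w.
(* Solves [2 * t - 1 = r], which makes the contraction [Z] the combination of [Y] and its reflection
   [Y'] with weights [t] and [1 - t]. *)
pose t := (1 + r) / 2.
have t01 : 0 < t < 1 by rewrite /t; lra.
have ZE w : Z w = t * Y w + (1 - t) * Y' w by rewrite /Z /t /Y'; field.
have mY' : measurable_fun setT Y' by exact: measurable_funB.
have ml := measurable_convex_loss cvx.
have EY' : ('E_P[l \o Y] = 'E_P[l \o Y'])%E by exact: expectation_eq_law.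
have iY := convex_loss_integrable _ mY Ylt.
have iY' : P.-integrable setT (EFin \o (l \o Y')).
  by apply: convex_loss_integrable => //; rewrite -EY'.
have mZ : measurable_fun setT Z.
  apply: measurable_funD => //; apply: measurable_funM => //.
  exact: measurable_funB.
pose U w := t * l (Y w) + (1 - t) * l (Y' w).
have iU : P.-integrable setT (EFin \o U).
  have -> : EFin \o U = (fun w => t%:E * (EFin \o (l \o Y)) w)%E \+
      (fun w => (1 - t)%:E * (EFin \o (l \o Y')) w)%E by [].
  by apply: integrableD => //; exact: integrableZl.
have EU : (\int[P]_w (U w)%:E = 'E_P[l \o Y])%E.
  rewrite /U; under eq_integral do rewrite EFinD !EFinM.
  rewrite integralD//=; [|exact: integrableZl|exact: integrableZl].
  rewrite !integralZl//= -[X in (t%:E * X)%E]/(\int[P]_w ((l \o Y) w)%:E)%E.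
  rewrite -[X in ((1 - t)%:E * X)%E]/(\int[P]_w ((l \o Y') w)%:E)%E.
  move: EY'; rewrite unlock => <-; rewrite -muleDl//.
    by rewrite -EFinD addrC subrK mul1e.
  by rewrite integrable_fin_num.
have ZU w : l (Z w) <= U w.
  by rewrite ZE; apply: convex_lossP => //; move/andP: t01 => [/ltW-> /ltW->].
have mlZ : measurable_fun setT (l \o Z) by exact: measurableT_comp.
(* [l (Z w)] is squeezed between [l z0] and [U w]. *)
have ilZ : P.-integrable setT (EFin \o (l \o Z)).
  apply: (@le_integrable _ _ _ _ _ measurableT _
    (EFin \o (fun w => `|U w| + `|l z0|))).
  - exact/measurable_EFinP.
  - move=> w _; rewrite /= lee_fin.
    have := convex_loss_min_le z0_min (Z w); have := ZU w.
    have := ler_norm (U w); have := ler_norm (- l z0); rewrite normrN.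
    rewrite (ger0_norm (addr_ge0 (normr_ge0 _) (normr_ge0 _))) ler_norml.
    have := normr_ge0 (U w); have := normr_ge0 (l z0).
    by move=> *; apply/andP; split; lra.
  - have -> : EFin \o (fun w => `|U w| + `|l z0|) =
        (EFin \o (Num.norm \o U)) \+ (EFin \o cst `|l z0|) :> (T -> \bar R).
      by [].
    apply: integrableD => //; first exact: integrable_norm.
    exact: finite_measure_integrable_cst.
pose D w := ((U w)%:E - (l (Z w))%:E)%E.
have mD : measurable_fun setT D.
  apply: emeasurable_funB; first exact: measurable_int iU.
  exact: measurable_int ilZ.
have D0 w : (0 <= D w)%E by rewrite /D -EFinB lee_fin subr_ge0.
have : (\int[P]_w `|D w| = 0)%E.
  under eq_integral do rewrite gee0_abs//.
  apply/eqP; rewrite eq_le integral_ge0// andbT.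
  rewrite /D integralB_EFin// EU.
  move: le_YZ; rewrite unlock => le_YZ; rewrite sube_le0.
  exact: le_YZ.
move=> /(ae_eq_integral_abs P measurableT mD)[N [mN N0 DN]].
move: tail; apply/negP; rewrite -leNgt -N0.
apply: le_measure; rewrite ?inE//.
- have -> : [set w | `|m - z0| < Y w - m] = Y @^-1` `]`|m - z0| + m, +oo[.
    by apply/seteqP; split => w; rewrite /= in_itv/= andbT ltrBrDr.
  by rewrite -[X in measurable X]setTI; exact: mY.
(* Here [Y w - m] exceeds [|m - z0|], so [Y w] is above [z0] and [Y' w] below it: the convexity
   inequality is strict. *)
- move=> w /= Bw; apply: DN => /= /(_ I); rewrite /D -EFinB => -[] /eqP.
  rewrite gt_eqF// subr_gt0 ZE /U; apply: (convex_loss_lt cvx z0_min _ _ _ t01).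
  have := ler_norm (m - z0); have := ler_norm (- (m - z0)); rewrite normrN.
  by rewrite /Y' => *; rewrite pmulr_rlt0; lra.
Qed.

End laws.

(** * Gaussian logits and the minimizer of the expected loss *)

Section gaussian.
Context {R : realType} {d : nat} {disp : measure_display}
  {T : measurableType disp} {P : probability T R} {X : T -> 'cV[R]_d}
  {mu : 'cV[R]_d} {Sigma : 'M[R]_d} {l : R -> R} {z0 : R}.
Hypothesis gX : gaussian_vector P X mu Sigma.
Hypothesis cvx : convex_loss l.
Hypothesis z0_min : forall z, z != z0 -> l z0 < l z.

Lemma gaussian_measurable_dot (u : 'cV[R]_d) :
  measurable_fun setT (fun w => dot u (X w)).
Proof.
have [_ _ mX _] := gX.
under eq_fun do rewrite dotE.
by apply: measurable_sum => i; apply: measurable_funM.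
Qed.

(** Covers both the contracted logit ([u = r *: S]) and the reflected one ([u = - S]), each up to a
    constant. *)
Lemma gaussian_dot_affine_law (u : 'cV[R]_d) (c : R) (A : set R) :
  measurable A ->
  P [set w | A (dot u (X w) + c)] =
  normal_law (dot u mu + c) (dot u (Sigma *m u)) A.
Proof.
have [_ psd _ law] := gX => mA; rewrite -normal_law_shift//.
apply: (law u (fun x => A (x + c))).
rewrite -[X in measurable X](setTI (fun x => A (x + c))).
have mf : measurable_fun setT (fun x : R => x + c) by exact: measurable_funD.
exact: (mf measurableT A mA).
Qed.

Lemma gaussian_expected_loss_lt (S0 S : 'cV[R]_d) : dot S0 mu = dot S mu ->
  dot S0 (Sigma *m S0) < dot S (Sigma *m S) ->
  (expected_loss P X l S < +oo)%E ->
  (expected_loss P X l S0 < expected_loss P X l S)%E.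
Proof.
have [sSigma psd mX law] := gX.
set v0 := dot S0 (_ *m _); set v := dot S (_ *m _) => m0 v0v Slt.
have v0_ge0 : 0 <= v0 by exact: psd.
have v_gt0 : 0 < v by exact: le_lt_trans v0v.
have sv0 : Num.sqrt v != 0 by rewrite sqrtr_eq0 -ltNge.
(* [r] is the ratio of the standard deviations of the two logits. It is zero when the logit of [S0]
   is degenerate. *)
pose m := dot S mu; pose Y w := dot S (X w); pose r := Num.sqrt (v0 / v).
have mY : measurable_fun setT Y by exact: gaussian_measurable_dot.
have -> : expected_loss P X l S0 =
    ('E_P[l \o (fun w => m + r * (Y w - m))%R])%E.
  apply: (@expectation_eq_law _ _ _ P (fun w => dot S0 (X w))) => //.
  - exact: gaussian_measurable_dot.
  - apply: measurable_funD => //; apply: measurable_funM => //.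
    exact: measurable_funB.
  - exact: measurable_convex_loss.
  move=> A mA; rewrite [LHS]law//.
  have rE w : m + r * (Y w - m) = dot (r *: S) (X w) + (1 - r) * m.
    by rewrite dotZl -/(Y w); ring.
  have -> : (fun w => m + r * (Y w - m)) @^-1` A =
      [set w | A (dot (r *: S) (X w) + (1 - r) * m)].
    by apply/seteqP; split => w /=; rewrite rE.
  rewrite (gaussian_dot_affine_law (r *: S) ((1 - r) * m) A mA).
  have -> : dot (r *: S) mu + (1 - r) * m = dot S0 mu.
    by rewrite m0 dotZl -/m; ring.
  have -> // : dot (r *: S) (Sigma *m (r *: S)) = v0.
  rewrite dotZl -scalemxAr dotZr mulrA -expr2 sqr_sqrtr.
    by rewrite divfK// gt_eqF.
  by rewrite divr_ge0// ltW.
apply: (expected_loss_contraction_lt P cvx z0_min Y) => //.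
(* The reflection is the functional [- S] shifted by [2 * m], which has the same mean and variance
   as [Y]. *)
- move=> A mA; rewrite [LHS]law//.
  have YE w : 2 * m - Y w = dot (- S) (X w) + 2 * m by rewrite dotNl addrC.
  have -> : (fun w => 2 * m - Y w) @^-1` A =
      [set w | A (dot (- S) (X w) + 2 * m)].
    by apply/seteqP; split => w /=; rewrite YE.
  rewrite (gaussian_dot_affine_law (- S) (2 * m) A mA).
  have -> : dot (- S) mu + 2 * m = dot S mu by rewrite dotNl -/m; ring.
  by rewrite mulmxN dotNl dotNr opprK.
- rewrite (law S [set x | `|m - z0| < x - m]); last first.
    rewrite [X in measurable X](_ : _ = `]`|m - z0| + m, +oo[%classic).
      exact: measurable_itv.
    by apply/seteqP; split => x; rewrite /= in_itv/= andbT ltrBrDr.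
  by rewrite /normal_law (gt_eqF v_gt0); exact: normal_prob_tail_gt0.
- by rewrite sqrtr_ge0/= -sqrtr1 ltr_sqrt// ltr_pdivrMr// mul1r.
Qed.

Lemma expected_loss_argmin_lty (S : 'cV[R]_d) :
  is_argmin (expected_loss P X l) S -> (expected_loss P X l S < +oo)%E.
Proof.
move=> /(_ 0); move/le_lt_trans; apply.
rewrite /expected_loss unlock; under eq_integral do rewrite dot0l.
by rewrite integral_cst//= probability_setT mule1 ltry.
Qed.

Lemma gaussian_argmin (S : 'cV[R]_d) : Sigma \in unitmx -> mu != 0 ->
  is_argmin (expected_loss P X l) S ->
  exists c, S = c *: (invmx Sigma *m mu).
Proof.
have [sSigma psd _ _] := gX => uSigma mu0 Smin.
set b := invmx Sigma *m mu.
have Sb : Sigma *m b = mu by rewrite mulKVmx.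
have b0 : b != 0 by apply: contraNneq mu0 => b0; rewrite -Sb b0 mulmx0.
have b_gt0 := psd_unitmx_gt0 sSigma psd uSigma b0.
rewrite Sb in b_gt0.
(* Chosen so that [c *: b] and [S] have the same mean logit; the denominator equals
   [dot b (Sigma *m b)], which is positive. *)
pose c := dot S mu / dot b mu; exists c.
apply/eqP; rewrite -subr_eq0; apply/negPn/negP => V0.
have V_gt0 := psd_unitmx_gt0 sSigma psd uSigma V0.
set V := S - c *: b in V0 V_gt0.
have cbmu : dot (c *: b) mu = dot S mu by rewrite dotZl divfK// gt_eqF.
have Vmu : dot V mu = 0 by rewrite dotDl dotNl cbmu subrr.
have SE : S = c *: b + V by rewrite addrC subrK.
clearbody V.
have V_lt : dot (c *: b) (Sigma *m (c *: b)) < dot S (Sigma *m S).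
  (* The cross terms vanish because [Sigma *m (c *: b) = c *: mu] is orthogonal to [V]; what remains
     in excess is the variance along [V]. *)
  rewrite [in ltRHS]SE mulmxDr !(dotDl, dotDr).
  rewrite (@dot_symmx _ _ _ (c *: b) V sSigma).
  by rewrite -scalemxAr Sb !dotZr Vmu mulr0 addr0 add0r ltrDl.
have := gaussian_expected_loss_lt (c *: b) S cbmu V_lt
  (expected_loss_argmin_lty S Smin).
by move/lt_le_trans => /(_ _ (Smin (c *: b))); rewrite ltxx.
Qed.

End gaussian.

(** * Minimizers of the empirical quadratic loss, and the conclusion *)

Lemma empirical_argmin (R : realType) (d N : nat) (x : 'I_N -> 'cV[R]_d)
    (a z : R) (S : 'cV[R]_d) : (0 < N)%N -> a != 0 ->
  empirical_cov x \in unitmx ->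
  is_argmin (empirical_loss x (quadratic_loss a z)) S ->
  exists c, S = c *: (invmx (empirical_cov x) *m empirical_mean x).
Proof.
move=> N0 a0 uC Smin; set m := empirical_mean x.
(* The gap between the target [z] and the mean logit, read off from the stationarity equation once
   the second moment is split into [empirical_cov x] and the outer product of [m]. *)
exists (z - dot m S).
rewrite scalemxAr; apply: (canRL (mulKmx uC)).
rewrite empirical_covE// mulmxBl mul_outer -/m scalerBl; congr (_ - _).
have := empirical_loss_stationary _ _ _ x _ _ _ N0 a0 Smin.
under eq_bigr do rewrite scalerBl.
rewrite sumrB -scaler_sumr => /eqP; rewrite subr_eq0 => /eqP sumE.
rewrite -scalemxAl mulmx_suml.
under eq_bigr do rewrite mul_outer dotC.
by rewrite sumE scalerA mulrC -scalerA.
Qed.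

Theorem corollary3p3 (R : realType) :
  (forall (d : nat) (disp : measure_display) (T : measurableType disp)
          (P : probability T R) (X : T -> 'cV[R]_d)
          (mu : 'cV[R]_d) (Sigma : 'M[R]_d) (l : R -> R),
      gaussian_vector P X mu Sigma ->
      Sigma \in unitmx ->
      mu != 0 ->
      convex_loss l ->
      has_unique_min l ->
      forall Smin : 'cV[R]_d,
        is_argmin (expected_loss P X l) Smin ->
        Smin != 0 ->
        propto (direction Smin) (invmx Sigma *m mu))
  /\
  (forall (d N : nat) (x : 'I_N -> 'cV[R]_d) (a zstar : R),
      (0 < N)%N ->
      d%:R / N%:R < 1 :> R ->
      a != 0 ->
      empirical_cov x \in unitmx ->
      forall Smin : 'cV[R]_d,
        is_argmin (empirical_loss x (quadratic_loss a zstar)) Smin ->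
        Smin != 0 ->
        propto (direction Smin) (invmx (empirical_cov x) *m empirical_mean x)).
Proof.
split.
- move=> d disp T P X mu Sigma l gX uSigma mu0 cvx [z0 z0_min] S Smin S0.
  have [c SE] := gaussian_argmin gX cvx z0_min S uSigma mu0 Smin.
  exact: propto_direction SE S0.
- move=> d N x a z N0 _ a0 uC S Smin S0.
  have [c SE] := empirical_argmin R d N x a z S N0 a0 uC Smin.
  exact: propto_direction SE S0.
Qed.
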